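(* If $(L,\vee,\wedge,0,1)$ is a bounded lattice, then $(\chi^{(L)},\preceq)$ is a sublattice of the lattice $(\mathrm{O}(L),\preceq)$, and it is isomorphic to $L$.
   Context: $\mathrm{O}(L)$ denotes the set of all maps $L\to L$, ordered by $d\preceq d'$ if and only if $d(x)\leq d'(x)$ for all $x\in L$; it is a lattice with pointwise join and meet. For $u\in L$, the map $\chi^{(u)}:L\to L$ is defined by $\chi^{(u)}(1)=u$ and $\chi^{(u)}(x)=x$ for $x\neq 1$. Set $\chi^{(L)}=\{\chi^{(u)}\mid u\in L\}$. *)

(* Defs.v *)
(* For a lattice L, the type L -> L is a lattice for the pointwise order,
   meet and join through the instances of boolp.FunOrder. *)
From mathcomp Require Import all_boot all_order.
From mathcomp Require Import boolp classical_sets functions.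

Set Implicit Arguments.
Unset Strict Implicit.
Unset Printing Implicit Defensive.

Local Open Scope order_scope.
Local Open Scope classical_set_scope.

Definition chi d (L : tbLatticeType d) (u : L) : L -> L :=
  fun x => if x == \top then u else x.

Definition chi_set d (L : tbLatticeType d) : set (L -> L) := range (@chi d L).
Arguments chi_set {d} L.

Definition is_sublattice d (M : latticeType d) (S : set M) : Prop :=
  [/\ S !=set0, Order.ClosedPredicates.meet_closed (mem S)
    & Order.ClosedPredicates.join_closed (mem S)].

(* Intended for a sublattice S of M: its lattice operations are then those
   of M, so an isomorphism from L onto S is a lattice morphism from L to M
   that is a bijection from L onto S. *)
Definition isomorphic_to_sublattice d (L : latticeType d)
    d' (M : latticeType d') (S : set M) : Prop :=
  exists f : {lmorphism L -> M}, set_bij [set: L] S f.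

(* Main.v *)
Require Import Defs.
From HB Require Import structures.
From mathcomp Require Import all_boot all_order.
From mathcomp Require Import boolp classical_sets functions.

(** The map [chi] sends [u] to the function that agrees with the identity off
    [\top] and takes the value [u] at [\top].  Meets and joins of functions are
    computed pointwise: off [\top] they are idempotent, and at [\top] they are
    those of [L].  So [chi] is a lattice morphism from [L] to [L -> L]
    ([chiI], [chiU]), and its range, [chi_set L], is closed under both
    operations.  Evaluation at [\top] recovers [u] from [chi u], so [chi] is
    injective ([chi_inj]), hence an isomorphism onto its range. *)

Import Order.TTheory.
Local Open Scope order_scope.
Local Open Scope classical_set_scope.

Section ChiMorphism.
Context {d : Order.disp_t} {L : tbLatticeType d}.

Lemma chi_top (u : L) : chi u \top = u.
Proof. by rewrite /chi eqxx. Qed.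

Lemma chi_inj : injective (@chi d L).
Proof. by move=> u v /(congr1 (@^~ \top)); rewrite !chi_top. Qed.

Lemma chi_homo : {homo @chi d L : u v / u <= v}.
Proof. by move=> u v le_uv; apply/lefP => x; rewrite /chi; case: ifP. Qed.

Lemma chiI : Order.meet_morphism (@chi d L).
Proof.
by move=> u v; apply/funext => x; rewrite meetfE /chi; case: ifP; rewrite ?meetxx.
Qed.

Lemma chiU : Order.join_morphism (@chi d L).
Proof.
by move=> u v; apply/funext => x; rewrite joinfE /chi; case: ifP; rewrite ?joinxx.
Qed.

HB.instance Definition _ :=
  Order.isOrderMorphism.Build d L _ (L -> L) (@chi d L) chi_homo.
HB.instance Definition _ :=
  Order.isLatticeMorphism.Build d L _ (L -> L) (@chi d L) chiI chiU.

End ChiMorphism.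

Theorem proposition4p13 (d : Order.disp_t) (L : tbLatticeType d) :
  is_sublattice (chi_set L) /\ isomorphic_to_sublattice L (chi_set L).
Proof.
split.
  split.
  - by exists (chi \top), \top.
  - move=> f g /set_mem[u _ <-] /set_mem[v _ <-].
    by apply: mem_set; exists (u `&` v)%O; rewrite ?chiI.
  - move=> f g /set_mem[u _ <-] /set_mem[v _ <-].
    by apply: mem_set; exists (u `|` v)%O; rewrite ?chiU.
exists (@chi d L); split.
- by move=> u _; exists u.
- by move=> u v _ _ /chi_inj.
- by move=> f [u _ <-]; exists u.
Qed.
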